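(* Let $\mathcal H$ be a real Hilbert space, $K\subset\mathcal H$ a nonempty closed convex set, $q\ge1$ an integer, and let $f_i:\mathcal H\to\mathbb R$ ($i=1,\dots,q$) be convex continuous functions that are Lipschitz continuous on bounded sets and bounded from below on $\mathcal H$. Then for any strong global solution $u:[0,+\infty[\to\mathcal H$ of the Multi-Objective Gradient system $$\text{(MOG)}\qquad \dot u(t)+\Big(N_K(u(t))+\mathrm{Conv}\{\partial f_i(u(t))\}\Big)^0=0,$$ the following properties hold: i) (Finite energy property) $\displaystyle\int_0^{+\infty}\|\dot u(t)\|^2\,dt<+\infty$. ii) (Weak convergence) Assume that the trajectory $t\in[0,+\infty[\,\mapsto u(t)$ is bounded in $\mathcal H$. Then $u(t)$ converges weakly in $\mathcal H$ as $t\to+\infty$ to a weak Pareto optimum.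
   Context: $N_K(u)=\{\eta\in\mathcal H:\langle\eta,v-u\rangle\le0\ \forall v\in K\}$ for $u\in K$ (and $N_K(u)=\emptyset$ for $u\notin K$) is the normal cone; $\partial f_i$ is the convex subdifferential. $\mathcal S^q=\{\theta\in\mathbb R^q:0\le\theta_i\le1,\ \sum_i\theta_i=1\}$ and $\mathrm{Conv}\{\partial f_i(u)\}=\{\sum_{i=1}^q\theta_ip_i:\ p_i\in\partial f_i(u),\ (\theta_i)\in\mathcal S^q\}$. For a nonempty closed convex set $C$, $C^0$ is its element of minimal norm. A weak Pareto optimum is a point $u\in K$ such that there is no $v\in K$ with $f_i(v)<f_i(u)$ for all $i=1,\dots,q$. A strong global solution of (MOG) is a function $u:[0,+\infty[\to\mathcal H$ such that: (i) $u$ is absolutely continuous on each interval $[0,T]$, $0<T<+\infty$ (i.e. $u(t)=u(0)+\int_0^tg(s)\,ds$ for some integrable $g:[0,T]\to\mathcal H$); (ii) there exist $\eta:[0,+\infty[\to\mathcal H$, $v_i:[0,+\infty[\to\mathcal H$, $\theta_i:[0,+\infty[\to[0,1]$ ($i=1,\dots,q$) with $\theta_i\in L^\infty(0,+\infty;\mathbb R)$, $(\theta_i(t))\in\mathcal S^q$ for a.e. $t>0$; $v_i\in L^\infty(0,T;\mathcal H)$ and $\eta\in L^2(0,T;\mathcal H)$ for all $T>0$; and for a.e. $t>0$: $\eta(t)\in N_K(u(t))$, $v_i(t)\in\partial f_i(u(t))$, $\dot u(t)+\eta(t)+\sum_i\theta_i(t)v_i(t)=0$, and $\dot u(t)+\big(N_K(u(t))+\mathrm{Conv}\{\partial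 f_i(u(t))\}\big)^0=0$. *)

(* Defs.v *)
From HB Require Import structures.
From mathcomp Require Import all_boot all_order all_algebra.
From mathcomp Require Import all_classical all_reals all_analysis.
Set Implicit Arguments.
Unset Strict Implicit.
Unset Printing Implicit Defensive.
Import Order.TTheory GRing.Theory Num.Theory.
Import numFieldNormedType.Exports.
Local Open Scope classical_set_scope.
Local Open Scope ring_scope.

(* Vector-valued integration, built from simple functions.  Almost everywhere
   limits make strong measurability the Lebesgue one although the underlying
   sigma-algebra is the Borel one; the library integral of a nonnegative
   function is a supremum over simple functions below it, which is the Lebesgue
   integral for the Lebesgue measurable functions integrated here. *)
Section Bochner.
Context {R : realType} {V : normedModType R}.
Local Notation mu := (@lebesgue_measure R).
Implicit Types (D : set R) (g : R -> V).

Definition simple_fun g : Prop :=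
  finite_set (range g) /\ forall x : V, measurable (g @^-1` [set x]).

(* Meant for simple functions that are integrable on D: there, `fine` can only
   hide an infinite measure in front of x = 0. *)
Definition simple_integral D g : V :=
  \sum_(x \in range g) fine (mu (D `&` g @^-1` [set x])) *: x.

Definition strongly_measurable D g : Prop :=
  exists s : nat -> R -> V,
    (forall n, simple_fun (s n)) /\
    {ae mu, forall t, D t -> s n t @[n --> \oo] --> g t}.

Definition bochner_integrable D g : Prop :=
  strongly_measurable D g /\ (\int[mu]_(t in D) (`|g t|)%:E < +oo)%E.

Definition is_bochner_integral D g (I : V) : Prop :=
  bochner_integrable D g /\
  exists s : nat -> R -> V,
    [/\ forall n, simple_fun (s n),
        (\int[mu]_(t in D) (`|s n t - g t|)%:E)%E @[n --> \oo] --> 0%E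
      & simple_integral D (s n) @[n --> \oo] --> I].

Definition in_L2 D g : Prop :=
  strongly_measurable D g /\ (\int[mu]_(t in D) (`|g t| ^+ 2)%:E < +oo)%E.

Definition in_Linfty D g : Prop :=
  strongly_measurable D g /\
  exists M : R, {ae mu, forall t, D t -> `|g t| <= M}.

Definition absolutely_continuous_on (T : R) (u : R -> V) : Prop :=
  exists2 g : R -> V, bochner_integrable `[0, T] g &
    forall t, 0 <= t <= T -> is_bochner_integral `[0, t] g (u t - u 0).

End Bochner.

Section MultiObjective.
Context {R : realType} {H : completeNormedModType R}.
Variable dot : {dot H for idfun}.

Definition normal_cone (K : set H) (u : H) : set H :=
  [set eta | K u /\ forall v, K v -> dot eta (v - u) <= 0].

Definition subdifferential (f : H -> R) (u : H) : set H :=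
  [set p | forall v, f u + dot p (v - u) <= f v].

Definition simplex (q : nat) : set ('I_q -> R) :=
  [set theta | (forall i, 0 <= theta i <= 1) /\ \sum_i theta i = 1].

Definition conv_subdifferential (q : nat) (f : 'I_q -> H -> R) (u : H)
    : set H :=
  [set x | exists (theta : 'I_q -> R) (p : 'I_q -> H),
    [/\ simplex theta, forall i, subdifferential (f i) u (p i)
      & x = \sum_i theta i *: p i]].

(* z = C^0, as a relation, so that nothing is assumed of C. *)
Definition is_min_norm (C : set H) (z : H) : Prop :=
  C z /\ forall y, C y -> `|z| <= `|y|.

Definition mog_set (q : nat) (K : set H) (f : 'I_q -> H -> R) (u : H) : set H :=
  [set x + y | x in normal_cone K u & y in conv_subdifferential f u].

Definition weak_pareto (q : nat) (K : set H) (f : 'I_q -> H -> R) (u : H)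
    : Prop :=
  K u /\ ~ exists2 v, K v & forall i, f i v < f i u.

(* Functions on [0, +oo[ are total functions on R of which only the values at
   t >= 0 matter.  [derive1] is a total operator, hence the explicit
   [derivable]. *)
Definition strong_global_solution (q : nat) (K : set H) (f : 'I_q -> H -> R)
    (u : R -> H) : Prop :=
  (forall T, 0 < T -> absolutely_continuous_on T u) /\
  exists (eta : R -> H) (v : 'I_q -> R -> H) (theta : 'I_q -> R -> R^o),
    [/\ forall i t, 0 <= t -> 0 <= theta i t <= 1,
        forall i, in_Linfty `]0, +oo[ (theta i),
        {ae lebesgue_measure, forall t : R, 0 < t ->
          simplex (fun i => theta i t)},
        forall T, 0 < T ->
          (forall i, in_Linfty `]0, T[ (v i)) /\ in_L2 (`]0, T[) eta
      & {ae lebesgue_measure, forall t : R, 0 < t ->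
          [/\ normal_cone K (u t) (eta t),
              forall i, subdifferential (f i) (u t) (v i t),
              derivable u t 1,
              derive1 u t + eta t + \sum_i theta i t *: v i t = 0
            & exists2 z, is_min_norm (mog_set K f (u t)) z &
                derive1 u t + z = 0]}].

Definition weakly_cvg_pinfty (u : R -> H) (l : H) : Prop :=
  forall h : H, dot (u t) h @[t --> +oo] --> dot l h.

End MultiObjective.

(* Main.v *)
(* Write u' = - z with z = x + sum_j theta_j p_j of minimal norm, x in N_K(u)
   and p_j in the subdifferential of f_j at u.  Minimality against the segment
   from z to x + p_i gives <x + p_i, u'> <= - |u'|^2, and <x, u'> >= 0 because
   u stays in K, so every f_i decreases along u at rate at least |u'|^2; as f_i
   is bounded below, the energy is finite.  Along a bounded trajectory, the
   distance to any z in S = {z in K | f_i z <= lim_t f_i (u t) for all i} is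
   nonincreasing, and the weak limit points lie in S: this is Opial's argument,
   where a point common to all the closed convex hulls of the tails of a
   sequence plays the role of a weak limit point.  If some v in K improved all
   the f_i strictly over the limit, then |u'| would be bounded away from 0,
   contradicting the finite energy. *)
Require Import Defs.
From HB Require Import structures.
From mathcomp Require Import all_boot all_order all_algebra finmap.
From mathcomp Require Import all_classical all_reals all_analysis.
From mathcomp Require Import measurable_realfun ring lra.
Set Implicit Arguments.
Unset Strict Implicit.
Unset Printing Implicit Defensive.
Import Order.TTheory GRing.Theory Num.Theory.
Import numFieldNormedType.Exports.
Local Open Scope classical_set_scope.
Local Open Scope ring_scope.

(** * Inner product and closed convex sets *)

Section InnerProduct.
Context {R : realType} {H : completeNormedModType R}.
Context (dot : {dot H for idfun}) (dot_norm : forall x : H, dot x x = `|x| ^+ 2).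
Implicit Types (x y z e : H) (C : set H).

Lemma dotC x y : dot x y = dot y x.
Proof. by rewrite hermC expr0 mul1r. Qed.

Lemma dotZl (a : R) x y : dot (a *: x) y = a * dot x y.
Proof. exact: linearZl_LR. Qed.

Lemma dotZr (a : R) x y : dot x (a *: y) = a * dot x y.
Proof. exact: linearZr_LR. Qed.

Lemma dotDl x y z : dot (x + y) z = dot x z + dot y z.
Proof. exact: linearDl. Qed.

Lemma dotDr x y z : dot x (y + z) = dot x y + dot x z.
Proof. exact: linearDr. Qed.

Lemma dotNl x y : dot (- x) y = - dot x y.
Proof. exact: linearNl. Qed.

Lemma dotNr x y : dot x (- y) = - dot x y.
Proof. exact: linearNr. Qed.

Lemma dotBl x y z : dot (x - y) z = dot x z - dot y z.
Proof. exact: linearBl. Qed.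

Lemma dotBr x y z : dot x (y - z) = dot x y - dot x z.
Proof. exact: linearBr. Qed.

Lemma normD_sqr x y : `|x + y| ^+ 2 = `|x| ^+ 2 + 2 * dot x y + `|y| ^+ 2.
Proof. by rewrite -!dot_norm dotDl !dotDr (dotC y x); ring. Qed.

Lemma normB_sqr x y : `|x - y| ^+ 2 = `|x| ^+ 2 - 2 * dot x y + `|y| ^+ 2.
Proof. by rewrite normD_sqr dotNr normrN; ring. Qed.

Lemma cauchy_schwarz x y : `|dot x y| <= `|x| * `|y|.
Proof.
have [->|y0] := eqVneq y 0; first by rewrite linear0r !normr0 mulr0.
have ny0 : 0 < `|y| by rewrite normr_gt0.
have := sqr_ge0 (`|x - (dot x y / `|y| ^+ 2) *: y|).
rewrite normB_sqr dotZr normrZ exprMn.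
set d := dot x y; set n := `|y|; have -> : `|d / n ^+ 2| ^+ 2 = (d / n ^+ 2) ^+ 2.
  by rewrite -normrX ger0_norm ?sqr_ge0.
move=> h.
have {}h : 0 <= `|x| ^+ 2 * n ^+ 2 - d ^+ 2.
  have -> : `|x| ^+ 2 * n ^+ 2 - d ^+ 2 =
      n ^+ 2 * (`|x| ^+ 2 - 2 * (d / n ^+ 2 * d) + (d / n ^+ 2) ^+ 2 * n ^+ 2).
    by field; rewrite gt_eqF.
  by rewrite mulr_ge0 ?sqr_ge0.
rewrite -(@ler_pXn2r _ 2)// ?nnegrE ?mulr_ge0 ?(ltW ny0)//.
have -> : `|d| ^+ 2 = d ^+ 2 by rewrite -normrX ger0_norm ?sqr_ge0.
by rewrite exprMn -subr_ge0.
Qed.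

(** Polarization writes [dot] through norms of sums and differences, so its joint continuity reduces
    to continuity of the norm. *)
Lemma cvg_dot {T : Type} (F : set_system T) {FF : Filter F} (f g : T -> H) x y :
  f @ F --> x -> g @ F --> y -> (fun t => dot (f t) (g t)) @ F --> dot x y.
Proof.
move=> fx gy.
have E t : dot (f t) (g t) = 4^-1 * (`|f t + g t| ^+ 2 - `|f t - g t| ^+ 2).
  by rewrite normB_sqr normD_sqr; field.
under eq_fun do rewrite E.
have -> : dot x y = 4^-1 * (`|x + y| ^+ 2 - `|x - y| ^+ 2).
  by rewrite normB_sqr normD_sqr; field.
apply: cvgMr; apply: cvgB; rewrite expr2; under eq_fun do rewrite expr2.
  by apply: cvgM; apply: cvg_norm; apply: cvgD.
by apply: cvgM; apply: cvg_norm; apply: cvgB.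
Qed.

Lemma convex_setP C : convex_set C -> forall x y (l : R),
  C x -> C y -> 0 < l < 1 -> C (l *: x + (1 - l) *: y).
Proof.
move=> /convex_setW cC x y l Cx Cy /andP[l0 l1].
have := cC x y; rewrite !inE => /(_ Cx Cy (Itv01 (ltW l0) (ltW l1)) l0 l1).
by rewrite inE.
Qed.

Lemma convex_functionP (f : H -> R) : convex_function setT f ->
  forall x y (l : R), 0 < l < 1 ->
    f (l *: x + (1 - l) *: y) <= l * f x + (1 - l) * f y.
Proof.
move=> cf x y l /andP[l0 l1].
by have := @cf (Itv01 (ltW l0) (ltW l1)) x y; rewrite !inE => /(_ I I).
Qed.

(** For a closed set, stability under midpoints amounts to convexity, and midpoints are what the
    parallelogram identity uses. *)
Definition closed_convex C := closed C /\
  forall x y, C x -> C y -> C (2^-1 *: (x + y)).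

Lemma closed_convex_set C : closed C -> convex_set C -> closed_convex C.
Proof.
move=> clC cC; split => // x y Cx Cy.
rewrite scalerDr [X in _ + X](_ : _ = (1 - 2^-1) *: y).
  by apply: convex_setP => //; rewrite invr_gt0 ltr0n invf_lt1 ?ltr1n ?ltr0n.
by congr (_ *: _); field.
Qed.

Lemma closed_convex_sublevel (f : H -> R) (c : R) : continuous f ->
  convex_function setT f -> closed_convex [set x | f x <= c].
Proof.
move=> cf xf; split.
  apply: (@closed_comp _ _ f [set r | r <= c]); last exact: closed_le.
  by move=> x _; exact: cf.
move=> x y /= fx fy.
have h : 0 < (2^-1 : R) < 1 by rewrite invr_gt0 ltr0n invf_lt1 ?ltr1n ?ltr0n.
have := convex_functionP xf x y h.
rewrite scalerDr (_ : 1 - 2^-1 = 2^-1); last by field.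
move=> /le_trans; apply; lra.
Qed.

Lemma closed_convex_halfspace e (c : R) : closed_convex [set x | dot x e <= c].
Proof.
split.
  apply: (@closed_comp _ _ (dot^~ e) [set r | r <= c]); last exact: closed_le.
  by move=> x _; apply: cvg_dot; [exact: cvg_id|exact: cvg_cst].
move=> x y /= fx fy; rewrite dotZl dotDl; lra.
Qed.

Lemma closed_convex_bigcap (I : Type) (P : set I) (F : I -> set H) :
  (forall i, P i -> closed_convex (F i)) -> closed_convex (\bigcap_(i in P) F i).
Proof.
move=> cF; split; first by apply: closed_bigI => i /cF[].
by move=> x y Fx Fy i Pi; have [_] := cF _ Pi; apply; [exact: Fx|exact: Fy].
Qed.

(** These points form the intersection of the closed convex hulls of the tails; by Mazur's theorem
    it contains every weak limit of a subsequence. *)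
Definition hull_cluster (w : nat -> H) x :=
  forall C, closed_convex C -> (exists N, forall n, (N <= n)%N -> C (w n)) -> C x.

(* The points of (almost) minimal norm of the decreasing closed convex hulls of
   the tails form a Cauchy sequence by the parallelogram identity, so that no
   weak compactness is needed. *)
Lemma hull_cluster_exists (w : nat -> H) (B : R) :
  (forall n, `|w n| <= B) -> exists x, hull_cluster w x.
Proof.
move=> wB.
pose F N := [set C | closed_convex C /\ forall n, (N <= n)%N -> C (w n)].
pose D N := \bigcap_(C in F N) C.
have cD N : closed_convex (D N) by apply: closed_convex_bigcap => C [].
have Dw N n : (N <= n)%N -> D N (w n) by move=> Nn C [_]; apply.
have DS N M : (N <= M)%N -> D M `<=` D N.
  move=> NM x Dx C [cC Cw]; apply: Dx; split => // n Mn.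
  exact/Cw/(leq_trans NM).
pose S N := [set `|x| ^+ 2 | x in D N].
have Slb N : has_inf (S N).
  split; first by exists (`|w N| ^+ 2), (w N) => //; exact: Dw.
  by exists 0 => _ [x _ <-]; rewrite sqr_ge0.
(* The squared distance from 0 to [D N]: nondecreasing in [N] and bounded by [B ^+ 2], hence
   convergent. *)
pose d N := inf (S N).
have dle N x : D N x -> d N <= `|x| ^+ 2.
  by move=> Dx; apply: ge_inf; [case: (Slb N)|exists x].
have dnd : nondecreasing_seq d.
  move=> N M NM; apply: lb_le_inf; first by case: (Slb M).
  by move=> _ [x Dx <-]; apply: dle; exact: DS Dx.
have dB : has_ubound (range d).
  exists (B ^+ 2) => _ [N _ <-]; apply: (@le_trans _ _ (`|w N| ^+ 2)).
    by apply: dle; apply: Dw.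
  by rewrite lerXn2r ?nnegrE// (le_trans _ (wB N)).
have dcv := nondecreasing_is_cvgn dnd dB.
have ex N : exists x, D N x /\ `|x| ^+ 2 <= d N + N.+1%:R^-1.
  have [|_ [x Dx <-] h] := @inf_adherent _ (S N) N.+1%:R^-1 _ (Slb N); first by [].
  by exists x; split => //; exact: ltW.
have [x hx] := choice ex.
(* The midpoint of [x N] and [x M] lies in [D N], so its squared norm is at least [d N]; the
   parallelogram identity does the rest. *)
have par N M : (N <= M)%N -> `|x N - x M| ^+ 2 <= 2 * (d M - d N) + 4 * N.+1%:R^-1.
  move=> NM; have [DN hN] := hx N; have [DM hM] := hx M.
  have := dle _ _ ((cD N).2 _ _ DN (DS _ _ NM _ DM)).
  rewrite normrZ exprMn gtr0_norm ?invr_gt0// => h.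
  have Mn : M.+1%:R^-1 <= N.+1%:R^-1 :> R by rewrite lef_pV2 ?posrE// ler_nat.
  move: h; rewrite normB_sqr normD_sqr.
  have -> : (2^-1 : R) ^+ 2 = 4^-1 by field.
  by move: hN hM Mn; move: (N.+1%:R^-1) (M.+1%:R^-1) (d N) (d M) (dot _ _)
    (`|x N| ^+ 2) (`|x M| ^+ 2) => a b dN dM c p r *; lra.
have cx : cvgn x.
  apply: cauchy_cvg; apply/cauchyP => e e0.
  (* The two terms in [par] will be below 2/8 and 4/8 of [e ^+ 2]. *)
  have e8 : 0 < e ^+ 2 / 8 by rewrite divr_gt0 ?exprn_gt0.
  have [N0 _ hN0] := near_infty_natSinv_lt (PosNum e8).
  have [N1 _ hN1] : \forall n \near \oo, `|limn d - d n| < e ^+ 2 / 8.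
    by have /cvgrPdist_lt/(_ _ e8) := dcv.
  pose N := maxn N0 N1; exists (x N).
  exists N => //= M /= NM; rewrite -ball_normE /=.
  rewrite -(@ltr_pXn2r _ 2)// ?nnegrE ?(ltW e0)//.
  have := par _ _ NM.
  have h0 := hN0 N (leq_maxl _ _).
  have h1 := hN1 N (leq_maxr _ _); move: h0 h1; rewrite -/N /= => h0.
  have dMl : d M <= limn d by exact: nondecreasing_cvgn_le.
  rewrite ltr_norml => /andP[_ h1] /le_lt_trans; apply.
  by move: (e8) h0 h1 dMl; move: (N.+1%:R^-1) (d N) (d M) (limn d) (e ^+ 2)
    => a dN dM l s *; lra.
exists (limn x) => C cC [N Cw].
suff : D N (limn x) by apply; split.
apply: (closed_cvg _ (cD N).1 _ _ cx).
by exists N => // M /= NM; apply: (DS _ _ NM); case: (hx M).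
Qed.

End InnerProduct.

(** * Opial's lemma with cluster points of closed convex hulls *)

Section Opial.
Context {R : realType} {H : completeNormedModType R}.
Context (dot : {dot H for idfun}) (dot_norm : forall x : H, dot x x = `|x| ^+ 2).
Implicit Types (x y z e : H) (u : R -> H).

(** For each [d > 0], the half-space of level [c + d] is closed, convex and contains a tail of
    [w]. *)
Lemma hull_cluster_dot_le (w : nat -> H) x e (c : R) :
  dot (w n) e @[n --> \oo] --> c -> hull_cluster w x -> dot x e <= c.
Proof.
move=> wc wx; apply/ler_addgt0Pr => d d0.
apply: (wx [set y | dot y e <= c + d]).
  exact: closed_convex_halfspace dot_norm _ _.
have [N _ hN] : \forall n \near \oo, dot (w n) e <= c + d.
  by apply: (cvgr_le c wc); rewrite ltrDl.
by exists N => n Nn; exact: hN.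
Qed.

Lemma hull_cluster_dot (w : nat -> H) x e (c : R) :
  dot (w n) e @[n --> \oo] --> c -> hull_cluster w x -> dot x e = c.
Proof.
move=> wc wx; apply/eqP; rewrite eq_le (hull_cluster_dot_le wc wx)/=.
rewrite -lerN2 -dotNr; apply: hull_cluster_dot_le wx.
under eq_fun do rewrite dotNr.
exact: cvgN.
Qed.

(** Convergence of the distances to two points [z], [z'] of [S] forces [dot (u t) (z - z')] to
    converge. Two cluster points [x], [l] in [S] thus have the same product with [x - l], so they
    coincide. Weak convergence follows, since a failure would produce a cluster point other than
    [l]. *)
Lemma opial u (S : set H) (B : R) :
  (forall t, 0 <= t -> `|u t| <= B) ->
  (forall z, S z -> exists l : R, `|u t - z| @[t --> +oo] --> l) ->
  (forall (s : nat -> R) x, s @ \oo --> +oo ->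
    hull_cluster (fun n => u (s n)) x -> S x) ->
  exists2 l, S l & weakly_cvg_pinfty dot u l.
Proof.
move=> uB Scvg Scl.
(* The condition [n%:R <= s n] ensures both that the times are nonnegative and that they tend to
   infinity. *)
have ubd (s : nat -> R) : (forall n, n%:R <= s n) -> forall n, `|u (s n)| <= B.
  by move=> sn n; apply: uB; exact: le_trans (sn n).
have sy (s : nat -> R) : (forall n, n%:R <= s n) -> s @ \oo --> +oo.
  by move=> sn; apply: ger_cvgy cvgr_idn; near=> n; exact: sn.
have [|l lc] := @hull_cluster_exists _ _ _ dot_norm (fun n => u n%:R) B.
  exact: ubd.
have Sl : S l by apply: Scl lc; exact: sy.
have dcv z z' : S z -> S z' -> exists c : R, dot (u t) (z - z') @[t --> +oo] --> c.
  move=> /Scvg[a ua] /Scvg[b ub].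
  have E t : dot (u t) (z - z') = 2^-1 * (`|u t - z'| * `|u t - z'|
     - `|u t - z| * `|u t - z| + `|z| ^+ 2 - `|z'| ^+ 2).
    by rewrite -!expr2 !(normB_sqr dot_norm) dotBr; field.
  exists (2^-1 * (b * b - a * a + `|z| ^+ 2 - `|z'| ^+ 2)).
  under eq_fun do rewrite E.
  apply: cvgMr; apply: cvgB; last exact: cvg_cst.
  by apply: cvgD; [apply: cvgB; exact: cvgM|exact: cvg_cst].
have uniq s x : (forall n, n%:R <= s n) -> hull_cluster (fun n => u (s n)) x ->
    x = l.
  move=> sn xc; have Sx : S x by apply: Scl xc; exact: sy.
  have [c hc] := dcv _ _ Sx Sl.
  have ex : dot x (x - l) = c.
    by apply: hull_cluster_dot xc; apply: cvg_comp hc; exact: sy.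
  have el : dot l (x - l) = c.
    by apply: hull_cluster_dot lc; apply: cvg_comp hc; exact: sy.
  apply/eqP; rewrite -subr_eq0 -normr_eq0 -sqrf_eq0 -dot_norm dotBl ex el.
  by rewrite subrr.
(* Otherwise some times [s n >= n] keep [u (s n)] in the half-space where the product with [h] is at
   least [dot l h + d]. A cluster point of this sequence lies there too, yet it equals [l]. *)
have lim_le h (d : R) : 0 < d -> \forall t \near +oo, dot (u t) h <= dot l h + d.
  move=> d0; apply: contrapT => nh.
  have ex n : exists t, n%:R <= t /\ dot l h + d <= dot (u t) h.
    apply: contrapT => ht; apply: nh; exists n%:R; split; first exact: num_real.
    move=> t nt; rewrite leNgt; apply/negP => /ltW ?; apply: ht; exists t.
    by split => //; exact: ltW.
  have [s hs] := choice ex.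
  have [|x xc] := @hull_cluster_exists _ _ _ dot_norm (fun n => u (s n)) B.
    by apply: ubd => n; case: (hs n).
  have xl : x = l by apply: uniq xc => n; case: (hs n).
  have : dot x (- h) <= - (dot l h + d).
    apply: (xc [set y | dot y (- h) <= - (dot l h + d)]).
      exact: closed_convex_halfspace dot_norm _ _.
    by exists 0%N => n _ /=; rewrite dotNr lerN2; case: (hs n).
  by rewrite xl dotNr lerN2 gerDl leNgt d0.
exists l => // h; apply/cvgrPdist_le => e e0; near=> t.
rewrite ler_distlC; apply/andP; split; last by near: t; exact: lim_le.
have : dot (u t) (- h) <= dot l (- h) + e by near: t; exact: lim_le.
by rewrite !dotNr; lra.
Unshelve. all: by end_near. Qed.

End Opial.

(** * Integrals and difference quotients *)

Section Integral.
Local Open Scope ereal_scope.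

Import HBNNSimple.

(* [f1] and [f2] need not be measurable: the integral of a nonnegative function
   is a supremum over the simple functions below it. *)
Lemma le_integral_ae d (T : measurableType d) (R : realType)
    (mu : {measure set T -> \bar R}) (D : set T) (f1 f2 : T -> \bar R) :
  (forall x, D x -> 0 <= f1 x) -> (forall x, D x -> 0 <= f2 x) ->
  {ae mu, forall x, D x -> f1 x <= f2 x} ->
  \int[mu]_(x in D) f1 x <= \int[mu]_(x in D) f2 x.
Proof.
move=> f10 f20 [N [mN muN f12]].
rewrite !ge0_integralE//; apply: ge_ereal_sup => _ [h /= hf1 <-].
have mNC := measurableC mN.
have -> : sintegral mu h = \int[mu]_(x in setT) (h x)%:E.
  by rewrite integral_nnsfun// patch_setT.
rewrite (ge0_negligible_integral mN)//; last 2 first.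
  exact/measurable_EFinP/measurable_funTS.
  by move=> x _; rewrite lee_fin.
rewrite setTD integral_nnsfun//; apply: ereal_sup_ubound.
(* Set to zero on the null set [N], the simple function [h] keeps its integral and lies below [f2]
   at every point of [D]. *)
exists (proj_nnsfun h mNC); last by rewrite mrestrict.
move=> x; rewrite -mrestrict patchE; case: ifPn => [|_]; last first.
  by rewrite patchE; case: ifPn => // /set_mem; exact: f20.
move=> /set_mem Nx; have := hf1 x; rewrite !patchE; case: ifPn => // /set_mem Dx.
move=> /le_trans; apply; apply: contrapT => nf.
by apply: Nx; apply: f12 => /=; apply/not_implyP.
Qed.

End Integral.

Section Quotient.
Context {R : realType}.
Local Notation mu := (@lebesgue_measure R).

Lemma cvg_quotient (V : normedModType R) (F : R -> V) (x : R) (s : nat -> R) :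
  derivable F x 1 -> s @ \oo --> 0 -> (forall n, s n != 0) ->
  (s n)^-1 *: (F (s n + x) - F x) @[n --> \oo] --> derive1 F x.
Proof.
move=> dF s0 sn0.
have hn : s @ \oo --> 0^'.
  move=> A /s0 hA; change (\forall n \near \oo, A (s n)).
  have {}hA : \forall n \near \oo, s n != 0 -> A (s n) by exact: hA.
  by apply: filterS hA => n; exact.
have dl : h^-1 *: (F (h + x) - F x) @[h --> 0^'] --> derive1 F x.
  rewrite derive1E; move: dF; rewrite /derivable /derive.
  by under eq_fun do rewrite [_ *: 1]mulr1.
exact: (cvg_comp _ _ hn dl).
Qed.

Lemma cvg_left_quotient (V : normedModType R) (F : R -> V) (x : R) :
  derivable F x 1 ->
  n.+1%:R *: (F x - F (x - n.+1%:R^-1)) @[n --> \oo] --> derive1 F x.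
Proof.
move=> dF; have h0 : - (n.+1%:R^-1 : R) @[n --> \oo] --> 0.
  by rewrite -oppr0; apply: cvgN; exact: cvg_harmonic.
have n0 n : - (n.+1%:R^-1 : R) != 0 by rewrite lt_eqF ?oppr_lt0 ?invr_gt0.
have := cvg_quotient dF h0 n0; apply: cvg_trans; apply: near_eq_cvg.
apply: nearW => n; rewrite /= invrN invrK scaleNr -scalerN opprB.
by rewrite [- _ + x]addrC.
Qed.

Lemma cvg_right_quotient (V : normedModType R) (F : R -> V) (x : R) :
  derivable F x 1 ->
  n.+1%:R *: (F (n.+1%:R^-1 + x) - F x) @[n --> \oo] --> derive1 F x.
Proof.
move=> dF; have n0 n : (n.+1%:R^-1 : R) != 0 by rewrite gt_eqF ?invr_gt0.
have := cvg_quotient dF (@cvg_harmonic R) n0; apply: cvg_trans.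
by apply: near_eq_cvg; apply: nearW => n; rewrite /= invrK.
Qed.

Lemma continuous_antiderivative (f : R -> R) (c d : R) : continuous f ->
  exists F : R -> R, forall x, c < x < d -> derivable F x 1 /\ derive1 F x = f x.
Proof.
move=> cf; exists (fun x => \int[mu]_(t in `[c, x]) f t)%R => x /andP[cx xd].
apply: continuous_FTC1_closed xd _ cx (cf x).
apply: continuous_compact_integrable; first exact: segment_compact.
exact/continuous_subspaceT.
Qed.

(** The backward quotient [P n] of an antiderivative [F] of [f] is a primitive of the integrand, and
    its values at [b] and [a] tend to [f b] and [f a]. *)
Lemma cvg_integral_quotient (f : R -> R) (a b : R) : a < b -> continuous f ->
  (\int[mu]_(t in `[a, b]) (n.+1%:R * (f t - f (t - n.+1%:R^-1)))%:E)%E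
    @[n --> \oo] --> (f b - f a)%:E.
Proof.
move=> ab cf.
(* The margins keep [t - n.+1%:R^-1], which is at least [a - 1], and [t] itself inside the open
   interval where [F] is derivable. *)
have [F dF] := @continuous_antiderivative f (a - 2) (b + 1) cf.
pose P (n : nat) t := n.+1%:R * (F t - F (t - n.+1%:R^-1)).
have n1 n : (0 < n.+1%:R^-1 :> R) && (n.+1%:R^-1 <= 1 :> R).
  by rewrite invr_gt0 ltr0n invf_le1// ler1n.
have dP n t : a <= t <= b ->
    is_derive t (1 : R) (P n) (n.+1%:R * (f t - f (t - n.+1%:R^-1))).
  move=> /andP[at_ tb]; have /andP[n0 nle1] := n1 n.
  have [|d1 e1] := dF t; first by apply/andP; split; lra.
  have [|d2 e2] := dF (t - n.+1%:R^-1).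
    by move: n0 nle1; move: (n.+1%:R^-1) => h *; apply/andP; split; lra.
  have i1 : is_derive t (1 : R) F (f t).
    by apply: DeriveDef => //; rewrite -derive1E.
  have i2 : is_derive (t - n.+1%:R^-1) (1 : R) F (f (t - n.+1%:R^-1)).
    by apply: DeriveDef => //; rewrite -derive1E.
  have i3 : is_derive t (1 : R) (fun t => F (t - n.+1%:R^-1)) (f (t - n.+1%:R^-1)).
    have i4 : is_derive t (1 : R) (fun t : R => t - n.+1%:R^-1) 1.
      exact: is_derive_shift.
    have := @is_derive1_comp _ F (fun t : R => t - n.+1%:R^-1) t _ _ i2 i4.
    by rewrite mulr1.
  have -> : P n = n.+1%:R *: (F - (fun t => F (t - n.+1%:R^-1))).
    by apply/funext.
  exact: is_deriveZ.
have E n : (\int[mu]_(t in `[a, b]) (n.+1%:R * (f t - f (t - n.+1%:R^-1)))%:E)%E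
    = (P n b - P n a)%:E.
  rewrite (@continuous_FTC2 _ _ (P n))// ?EFinB//.
  - apply: continuous_subspaceT => x; apply: cvgMr; apply: cvgB; first exact: cf.
    apply: (@continuous_comp _ _ _ (fun t : R => t - n.+1%:R^-1) f); last exact: cf.
    by apply: cvgB; [exact: cvg_id|exact: cvg_cst].
  - split.
    + move=> x; rewrite in_itv/= => /andP[ax xb].
      by have [|//] := dP n x; rewrite !ltW.
    + apply: cvg_at_right_filter; have [|d _] := dP n a; first by rewrite lexx ltW.
      by apply/differentiable_continuous/derivable1_diffP.
    + apply: cvg_at_left_filter; have [|d _] := dP n b; first by rewrite lexx ltW.
      by apply/differentiable_continuous/derivable1_diffP.
  - move=> x; rewrite in_itv/= => /andP[ax xb].
    by have [|_] := dP n x; rewrite ?derive1E// !ltW.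
under eq_fun do rewrite E.
apply: cvg_EFin; first by near=> n.
have [|da <-] := dF a; first by apply/andP; split; lra.
have [|db <-] := dF b; first by apply/andP; split; lra.
by apply: cvgB; exact: cvg_left_quotient.
Unshelve. all: by end_near. Qed.

(** Fatou's lemma for the backward quotients, which are nonnegative by monotonicity; the limit of
    their integrals is given by [cvg_integral_quotient]. *)
Lemma le_integral_quotient (f : R -> R) (W : R -> \bar R) (a b : R) : a < b ->
  continuous f -> {homo f : x y / x <= y} ->
  (forall t, 0 <= W t)%E ->
  {ae mu, forall t, t \in `[a, b] ->
    (W t <= limn_einf (fun n => (n.+1%:R * (f t - f (t - n.+1%:R^-1)))%:E))%E} ->
  (\int[mu]_(t in `[a, b]) W t <= (f b - f a)%:E)%E.
Proof.
move=> ab cf ndf W0 Wle.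
have q0 n t : (0 <= (n.+1%:R * (f t - f (t - n.+1%:R^-1)))%:E)%E.
  by rewrite lee_fin mulr_ge0// subr_ge0 ndf// gerBl.
apply: (@le_trans _ _ (\int[mu]_(t in `[a, b])
    limn_einf (fun n => (n.+1%:R * (f t - f (t - n.+1%:R^-1)))%:E))%E).
  apply: le_integral_ae => //.
  by move=> t _; rewrite limn_einf_lim; apply: lime_ge;
    [exact: is_cvg_einfs|near=> n; apply: le_ereal_inf_tmp => _ [m _ <-]].
apply: (le_trans (fatou _ _ _ _)) => //.
- move=> n; apply/measurable_EFinP/measurable_funM => //.
  apply: measurable_funB; first exact: measurable_funTS (continuous_measurable_fun cf).
  apply: measurable_funTS; apply: measurableT_comp.
    exact: continuous_measurable_fun.
  exact: measurable_funB.
- have h := cvg_integral_quotient ab cf.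
  by rewrite (cvg_limn_einf_sup h).1.
Unshelve. all: by end_near. Qed.

End Quotient.

(** * Bochner integrals and absolutely continuous curves *)

Section BochnerDot.
Context {R : realType} {H : completeNormedModType R}.
Context (dot : {dot H for idfun}) (dot_norm : forall x : H, dot x x = `|x| ^+ 2).
Local Notation mu := (@lebesgue_measure R).
Implicit Types (D : set R) (g s : R -> H) (e : H).

(** Since the range is finite, any preimage is a finite union of measurable level sets, whatever [F]
    is. *)
Lemma simple_fun_comp_measurable s (F : H -> R) : simple_fun s ->
  measurable_fun setT (F \o s).
Proof.
move=> [fs ms] _ B mB; rewrite setTI.
have -> : (F \o s) @^-1` B = \bigcup_(x in range s `&` F @^-1` B) s @^-1` [set x].
  apply/seteqP; split => [t Bt|t [x [_ Bx] sx]]; last by rewrite /= sx.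
  by exists (s t) => //; split => //; exists t.
apply: fin_bigcup_measurable => [|x _]; last exact: ms.
exact: finite_setIl.
Qed.

Lemma dot_simple_integral D s e : measurable D -> (mu D < +oo)%E ->
  simple_fun s -> (dot (simple_integral D s) e)%:E =
  (\int[mu]_(t in D) (dot (s t) e)%:E)%E.
Proof.
move=> mD Dfin [fs ms]; rewrite /simple_integral fsbig_finite//=.
set X := fset_set (range s).
have X_s t : s t \in X by rewrite in_fset_set// mem_set//; exists t.
have E t : (dot (s t) e)%:E =
    (\sum_(x <- X) (dot x e * \1_(s @^-1` [set x]) t)%:E)%E.
  rewrite sumEFin (bigD1_seq (s t) (X_s t) (fset_uniq _))/= indicE mem_set//.
  rewrite mulr1 big1 ?addr0// => x xs.
  rewrite indicE memNset ?mulr0//= => sx.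
  by rewrite sx eqxx in xs.
under eq_integral do rewrite E.
have i1 x : mu.-integrable D (EFin \o \1_(s @^-1` [set x])).
  apply: measurable_bounded_integrable => //.
    by apply: measurable_indic; exact: ms.
  exists 1; split => // M M1 t _ /=.
  by rewrite (le_trans _ (ltW M1))// indicE; case: (_ \in _); rewrite ?normr1 ?normr0.
rewrite integral_sum//; last first.
  by move=> x; under eq_fun do rewrite EFinM; apply: integrableZl (i1 x).
rewrite -applyrE raddf_sum/= -sumEFin; apply: eq_bigr => x _.
rewrite dotZl mulrC EFinM fineK; last first.
  rewrite ge0_fin_numE//; apply: le_lt_trans Dfin.
  apply: le_measure; [|exact: mem_set|by []].
  by apply/mem_set; apply: measurableI => //; exact: ms.
under eq_integral do rewrite EFinM.
rewrite integralZl//; last exact: i1.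
by rewrite integral_indic; [rewrite setIC|exact: mD|exact: ms].
Qed.

(** An almost everywhere limit of simple functions is Borel measurable only after a measurable null
    set is removed; [A] is what remains of [D]. *)
Lemma strongly_measurableP D g : measurable D -> strongly_measurable D g ->
  exists2 A, [/\ measurable A, A `<=` D & mu (D `\` A) = 0%E] &
    forall F : H -> R, continuous F -> measurable_fun A (F \o g).
Proof.
move=> mD [s [ss [N [mN muN sN]]]].
exists (D `\` N).
  split; [exact: measurableD|by move=> t []|].
  rewrite setDD; apply: subset_measure0 muN => //; exact: measurableI.
move=> F cF.
apply: (@measurable_fun_cvg _ _ _ _ (fun n => F \o s n)).
  by move=> n; apply: measurable_funTS; exact: simple_fun_comp_measurable.
move=> t [Dt Nt]; have sg : s n t @[n --> \oo] --> g t.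
  by apply: contrapT => nsg; apply: Nt; apply: sN => /= h; exact: nsg (h Dt).
exact: (cvg_comp _ _ sg (cF (g t))).
Qed.

End BochnerDot.

Section BochnerIntegral.
Context {R : realType} {H : completeNormedModType R}.
Context (dot : {dot H for idfun}) (dot_norm : forall x : H, dot x x = `|x| ^+ 2).
Local Notation mu := (@lebesgue_measure R).
Implicit Types (A D : set R) (g s : R -> H) (e : H).

Lemma le_integral_subset A D (f h : R -> \bar R) : A `<=` D ->
  (forall t, A t -> (0 <= f t)%E) -> (forall t, D t -> (0 <= h t)%E) ->
  (forall t, A t -> (f t <= h t)%E) ->
  (\int[mu]_(t in A) f t <= \int[mu]_(t in D) h t)%E.
Proof.
move=> AD f0 h0 fh; rewrite [leLHS]integral_mkcond [leRHS]integral_mkcond.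
apply: le_integral_ae; [by move=> t _; apply: erestrict_ge0|
  by move=> t _; apply: erestrict_ge0|].
apply: aeW => t _; rewrite !patchE; case: ifPn => [/set_mem At|_].
  by rewrite (mem_set (AD _ At)) fh.
by case: ifPn => // /set_mem /h0.
Qed.

Lemma simple_fun_bounded s : simple_fun s -> exists M : R, forall t, `|s t| <= M.
Proof.
move=> [fs _]; exists (\sum_(x <- fset_set (range s)) `|x|) => t.
have X_s : s t \in fset_set (range s).
  by rewrite in_fset_set// mem_set//; exists t.
by rewrite (bigD1_seq (s t) X_s (fset_uniq _))/= lerDl sumr_ge0.
Qed.

Lemma continuous_dotl e : continuous (dot^~ e).
Proof. by move=> x; apply: (cvg_dot dot_norm) (cvg_cst _); exact: cvg_id. Qed.

(** Pairing with [e] turns the vector integral into a scalar one. This is clear for simple functions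
    and passes to the limit, because by Cauchy-Schwarz the error is at most a multiple of the
    integral of the norm of [s n - g]. *)
Lemma dot_is_bochner_integral A D g (I : H) e :
  measurable D -> (mu D < +oo)%E ->
  measurable A -> A `<=` D -> mu (D `\` A) = 0%E ->
  (forall F : H -> R, continuous F -> measurable_fun A (F \o g)) ->
  is_bochner_integral D g I ->
  mu.-integrable A (EFin \o (fun t => dot (g t) e)) /\
  dot I e = \int[mu]_(t in A) dot (g t) e.
Proof.
move=> mD Dfin mA AD DA mg [[_ gfin] [s [ss sg sI]]].
have ig1 : mu.-integrable A (EFin \o (fun t => `|g t|)).
  apply/integrableP; split.
    by apply/measurable_EFinP; exact: (mg _ (@norm_continuous _ H)).
  apply: le_lt_trans gfin; apply: le_integral_subset => //= t _.
  by rewrite lee_fin normr_id.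
have ig : mu.-integrable A (EFin \o (fun t => dot (g t) e)).
  apply: le_integrable (integrableZl _ `|e| ig1) => //.
    by apply/measurable_EFinP; exact: (mg _ (@continuous_dotl e)).
  move=> t At; rewrite /= lee_fin mulrC (le_trans (cauchy_schwarz dot_norm _ _))//.
  by rewrite mulrC ler_norm.
have is1 n E : measurable E -> E `<=` D ->
    mu.-integrable E (EFin \o (fun t => dot (s n t) e)).
  move=> mE ED; apply: measurable_bounded_integrable => //.
  - apply: le_lt_trans Dfin.
    by apply: le_measure; [exact: mem_set|exact: mem_set|].

  - apply: measurable_funTS.
    exact: (simple_fun_comp_measurable (dot^~ e) (ss n)).
  - have [M sM] := simple_fun_bounded (ss n).
    exists (M * `|e|); split; first exact: num_real.
    move=> N MN t _; rewrite /= (le_trans (cauchy_schwarz dot_norm _ _))//.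
    by rewrite (le_trans _ (ltW MN))// ler_wpM2r.
(* The added 1 keeps [c] invertible when [e = 0]. *)
split=> //; pose c := `|e| + 1.
have c0 : 0 < c by rewrite ltr_wpDl.
have key n : (\int[mu]_(t in A) (`|dot (s n t) e - dot (g t) e|)%:E <=
    c%:E * \int[mu]_(t in D) (`|s n t - g t|)%:E)%E.
  have mh : measurable_fun A (fun t => `|dot (s n t) e - dot (g t) e|).
    apply: measurableT_comp => //; apply: measurable_funB.
      apply: measurable_funTS.
      exact: (simple_fun_comp_measurable (dot^~ e) (ss n)).
    exact: (mg _ (@continuous_dotl e)).
  (* The factor [c] is extracted from the integral over [A], where the integrand is known to be
     measurable, rather than from the one over [D]. *)
  rewrite (_ : (\int[mu]_(t in A) _ = c%:E * \int[mu]_(t in A)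
      (c^-1 * `|dot (s n t) e - dot (g t) e|)%:E)%E); last first.
    rewrite -ge0_integralZl_EFin ?ltW//.
    - by apply: eq_integral => t _; rewrite -EFinM mulrA mulfV ?gt_eqF// mul1r.
    - by move=> t _; rewrite lee_fin mulr_ge0// invr_ge0 ltW.
    - by apply/measurable_EFinP; exact: measurable_funM.
  rewrite lee_pmul2l//; apply: le_integral_subset => //.
    by move=> t _; rewrite lee_fin mulr_ge0// invr_ge0 ltW.
  move=> t At; rewrite lee_fin -(dotBl dot) ler_pdivrMl//.
  rewrite (le_trans (cauchy_schwarz dot_norm _ _))// mulrC ler_wpM2r//.
  by rewrite lerDl.
have E n : dot (simple_integral D (s n)) e = \int[mu]_(t in A) dot (s n t) e.
  apply: EFin_inj; rewrite (dot_simple_integral dot)//.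
  have -> : (\int[mu]_(t in D) (dot (s n t) e)%:E =
      \int[mu]_(t in D `\` (D `\` A)) (dot (s n t) e)%:E)%E.
    by apply: negligible_integral => //; [exact: measurableD|exact: is1].
  rewrite setDD setIidr// fineK//; apply: integrable_fin_num => //.
  exact: is1.
have cI : \int[mu]_(t in A) dot (s n t) e @[n --> \oo] --> dot I e.
  under eq_fun do rewrite -E.
  by apply: (cvg_dot dot_norm) (cvg_cst _).
apply: (@cvg_unique _ (@norm_hausdorff _ _) _ _ _ _ cI).
have [sfin s0] := (fine_cvgP _ _).1 sg.
have {}s0 : c * fine (\int[mu]_(t in D) (`|s n t - g t|)%:E)%E @[n --> \oo] --> 0.
  by rewrite -(mulr0 c); apply: cvgMr.
apply/cvgrPdist_le => d d0; near=> n.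
have fn : (\int[mu]_(t in D) (`|s n t - g t|)%:E)%E \is a fin_num by near: n.
rewrite distrC -RintegralB//; last exact: is1.
apply: (@le_trans _ _ (c * fine (\int[mu]_(t in D) (`|s n t - g t|)%:E)%E)).
  rewrite (le_trans (le_normr_Rintegral _ _))//.
    exact: (integrableB _ (is1 n A mA AD) ig).
  have An : (\int[mu]_(t in A) (`|dot (s n t) e - dot (g t) e|)%:E)%E \is a fin_num.
    rewrite ge0_fin_numE ?integral_ge0//; apply: le_lt_trans (key n) _.
    by rewrite -(fineK fn) -EFinM ltry.
  by rewrite /Rintegral -lee_fin EFinM (fineK An) (fineK fn); exact: key.
rewrite -[leRHS]addr0 -lerBlDl.
have : `|0 - c * fine (\int[mu]_(t in D) (`|s n t - g t|)%:E)%E| <= d.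
  by near: n; move/cvgrPdist_le : s0; apply.
by rewrite sub0r normrN; move=> /(le_trans (ler_norm _)); rewrite subr_le0.
Unshelve. all: by end_near. Qed.

End BochnerIntegral.

(** * Scalar majorants and moduli of absolutely continuous curves *)

Section AbsolutelyContinuous.
Context {R : realType} {H : completeNormedModType R}.
Context (dot : {dot H for idfun}) (dot_norm : forall x : H, dot x x = `|x| ^+ 2).
Local Notation mu := (@lebesgue_measure R).
Implicit Types (u : R -> H) (G : R -> R).

(** [G] is the norm of the density [g], cut to zero off the set [A] where [g] is measurable. Pairing
    the increment [e = u t - u s] with itself bounds its squared norm by its norm times the integral
    of [G], and one factor cancels. *)
Lemma absolutely_continuous_majorant (T : R) u :
  0 < T -> absolutely_continuous_on T u ->
  exists G, [/\ forall t, 0 <= G t, mu.-integrable setT (EFin \o G) &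
    forall s t, 0 <= s -> s <= t -> t <= T ->
      `|u t - u s| <= \int[mu]_(x in `]s, t]) G x].
Proof.
move=> T0 [g [mg gfin] gu].
have [A [mA AD DA] mgA] := strongly_measurableP (measurable_itv `[0, T]) mg.
pose G := (fun t => `|g t|) \_ A.
have G0 t : 0 <= G t by rewrite /G patchE; case: ifP.
have GA t : A t -> G t = `|g t| by move=> At; rewrite /G patchE mem_set.
have iG : mu.-integrable setT (EFin \o G).
  apply/integrableP; split.
    apply/measurable_EFinP; apply/(measurable_restrictT _ _).1 => //.
    exact: (mgA _ (@norm_continuous _ H)).
  apply: le_lt_trans gfin.
  rewrite [leRHS]integral_mkcond; apply: le_integral_subset => //= t _.
    by apply: erestrict_ge0 => x _; rewrite lee_fin.
  rewrite [leRHS]patchE ger0_norm//; case: ifPn => [_|/negP nD].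
    by rewrite lee_fin /G patchE; case: ifP => _; [exact: lexx|exact: normr_ge0].
  by rewrite lee_fin /G patchE ifF//; apply/negP => /set_mem /AD /mem_set.
have gI t e : 0 <= t -> t <= T ->
  mu.-integrable (A `&` `[0, t]) (EFin \o (fun t => dot (g t) e)) /\
  dot (u t - u 0) e = \int[mu]_(x in A `&` `[0, t]) dot (g x) e.
  move=> t0 tT; have sT : `[0, t]%classic `<=` `[0, T]%classic.
    by apply: subset_itvl; rewrite bnd_simp.
  apply: (@dot_is_bochner_integral _ _ dot dot_norm _ `[0, t]%classic).
  - exact: measurable_itv.
  - by rewrite lebesgue_measure_itv/=; case: ifP => _; rewrite ?ltry// -EFinB ltry.
  - by apply: measurableI => //; exact: measurable_itv.
  - by move=> x [].
  - apply: subset_measure0 DA => //.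
    + apply: measurableD; first exact: measurable_itv.
      by apply: measurableI => //; exact: measurable_itv.
    + by apply: measurableD => //; exact: measurable_itv.
    + move=> x [xt nA]; split; first exact: sT.
      by move=> Ax; apply: nA.
  - move=> F cF; apply: measurable_funS (mgA F cF) => //.
  - by apply: gu; rewrite t0.
exists G; split => // s t s0 st tT.
pose e := u t - u s.
have [i1 e1] := gI t e (le_trans s0 st) tT.
have [i2 e2] := gI s e s0 (le_trans st tT).
have mI : measurable (A `&` `]s, t]%classic).
  by apply: measurableI => //; exact: measurable_itv.
have U : A `&` `[0, t]%classic = (A `&` `[0, s]) `|` (A `&` `]s, t]%classic).
  rewrite -setIUr; congr (_ `&` _).
  by rewrite -itv_bndbnd_setU// bnd_simp.
have E : `|e| ^+ 2 = \int[mu]_(x in A `&` `]s, t]) dot (g x) e.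
  rewrite -dot_norm {1}/e (_ : u t - u s = (u t - u 0) - (u s - u 0)); last first.
    by rewrite opprB addrA subrK.
  rewrite dotBl e1 e2 U Rintegral_setU//.
  - by rewrite addrAC subrr add0r.
  - by apply: measurableI => //; exact: measurable_itv.
  - by rewrite -U.
  - apply/disj_set2P; rewrite setIACA setIid -subset0 => x [_ []].
    by rewrite /= !in_itv/= => /andP[_ xs] /andP[/lt_le_trans/(_ xs)]; rewrite ltxx.
have i3 : mu.-integrable (A `&` `]s, t]%classic) (EFin \o G).
  by apply: integrableS iG.
have i3' : mu.-integrable `]s, t]%classic (EFin \o G).
  by apply: integrableS iG => //; exact: measurable_itv.
have i4 : mu.-integrable (A `&` `]s, t]%classic) (EFin \o (fun t => dot (g t) e)).
  apply: integrableS i1 => //.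
    by apply: measurableI => //; exact: measurable_itv.
  by rewrite U; exact: subsetUr.
have le1 : `|e| ^+ 2 <= `|e| * \int[mu]_(x in `]s, t]) G x.
  rewrite E; apply: (@le_trans _ _ (\int[mu]_(x in A `&` `]s, t]) (`|e| * G x))).
    apply: le_Rintegral => //; first exact: (integrableZl _ `|e| i3).
    move=> x [Ax _]; rewrite GA// mulrC.
    by rewrite (le_trans (ler_norm _))// (cauchy_schwarz dot_norm).
  rewrite RintegralZl// ler_wpM2l//; apply: fine_le.
  - exact: integrable_fin_num.
  - by apply: integrable_fin_num => //; exact: measurable_itv.
  - by apply: le_integral_subset => // x _; rewrite lee_fin.
have [e0|e0] := eqVneq e 0; first by rewrite -/e e0 normr0 Rintegral_ge0.
by move: le1; rewrite expr2 ler_pM2l// normr_gt0.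
Qed.

(** [F] integrates [G] from minus infinity: absolute continuity of the integral makes it continuous,
    and the Lebesgue differentiation theorem gives its derivative almost everywhere. *)
Lemma cumulative_function G : (forall t, 0 <= G t) ->
  mu.-integrable setT (EFin \o G) ->
  exists F : R -> R, [/\ continuous F, {homo F : x y / x <= y},
    forall s t, s <= t -> F t - F s = \int[mu]_(x in `]s, t]) G x &
    {ae mu, forall t, derivable F t 1 /\ derive1 F t = G t}].
Proof.
move=> G0 iG; pose F x := \int[mu]_(t in `]-oo, x]) G t.
have iGi (i : interval R) : mu.-integrable [set` i] (EFin \o G).
  by apply: integrableS iG => //; exact: measurable_itv.
have FB s t : s <= t -> F t - F s = \int[mu]_(x in `]s, t]) G x.
  by move=> st; rewrite /F Rintegral_itvB.
have Fnd : {homo F : x y / x <= y}.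
  by move=> x y xy; rewrite -subr_ge0 FB// Rintegral_ge0.
exists F; split => //.
  move=> x; apply/cvgrPdist_lt => e e0.
  have [d [d0 dP]] := integral_normr_continuous iG e0.
  have key y z : y <= z -> `|y - z| < d -> `|F y - F z| < e.
    move=> yz yzd; rewrite distrC FB// ger0_norm ?Rintegral_ge0//.
    rewrite (_ : Rintegral _ _ _ = \int[mu]_(t in `]y, z]) `|G t|); last first.
      by apply: eq_Rintegral => t _; rewrite ger0_norm.
    apply: dP; first exact: measurable_itv.
    change (mu `]y, z]%classic < d%:E)%E.
    rewrite lebesgue_measure_itv/= lte_fin; case: ifP => // _.
    by rewrite -EFinB lte_fin (le_lt_trans _ yzd)// distrC ler_norm.
  near=> y.
  have yxd : `|x - y| < d by near: y; exact: (cvgr_dist_lt _ _ cvg_id).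
  by have [xy|/ltW yx] := leP x y; [exact: key|rewrite distrC key// distrC].
apply: FTC1Ny => //; have := integrable_locally measurableT iG.
by rewrite patch_setT.
Unshelve. all: by end_near. Qed.

Lemma le_limn_einf (v : nat -> \bar R) (x : \bar R) :
  (\forall n \near \oo, (x <= v n)%E) -> (x <= limn_einf v)%E.
Proof.
move=> [N _ hN]; rewrite limn_einf_lim; apply: lime_ge; first exact: is_cvg_einfs.
exists N => // n /= Nn; apply: le_ereal_inf_tmp => _ [m /= nm <-].
by apply: hN; exact: leq_trans nm.
Qed.

(* Fatou applied to the difference quotients of the nondecreasing function
   [C * F - f], where [F] is an antiderivative of the majorant. *)
Lemma integral_le_of_quotient G (F f w : R -> R) (C a b : R) :
  (forall t, 0 <= G t) -> mu.-integrable setT (EFin \o G) ->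
  continuous F ->
  (forall s t, s <= t -> F t - F s = \int[mu]_(x in `]s, t]) G x) ->
  {ae mu, forall t, derivable F t 1 /\ derive1 F t = G t} ->
  0 <= C -> continuous f ->
  (forall s t, s <= t -> `|f t - f s| <= C * (F t - F s)) ->
  measurable_fun setT w -> (forall t, 0 <= w t) -> a < b ->
  {ae mu, forall t, t \in `[a, b] -> forall e, 0 < e -> \forall n \near \oo,
    n.+1%:R * (f t - f (t - n.+1%:R^-1)) <= - w t + e} ->
  (\int[mu]_(t in `[a, b]) (w t)%:E <= (f a - f b)%:E)%E.
Proof.
move=> G0 iG cF FB dF C0 cf fF mw w0 ab fw.
pose X t := C * F t - f t.
have cX : continuous X.
  by move=> t; apply: cvgB; [apply: cvgMr; exact: cF|exact: cf].
have Xnd : {homo X : x y / x <= y}.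
  move=> x y xy; have := fF _ _ xy; rewrite mulrBr => /(le_trans (ler_norm _)).
  by rewrite /X; lra.
(* The quotients of [X] are eventually at least [C * G t + w t] up to any error. Afterwards the
   integral of [C * G] is finite, equals [C * (F b - F a)] and cancels. *)
have : (\int[mu]_(t in `[a, b]) (C * G t + w t)%:E <= (X b - X a)%:E)%E.
  apply: le_integral_quotient => // [t|].
    by rewrite lee_fin addr_ge0// mulr_ge0.
  apply: (@filterS2 _ _ (ae_filter_ringOfSetsType mu) _ _ _ _ dF fw) => t [dFt <-] fwt tab.
  apply/lee_addgt0Pr => e e0.
  rewrite -leeBlDr// -EFinB; apply: le_limn_einf.
  have /cvgrPdist_le Fq := cvg_left_quotient dFt.
  (* [C] may vanish, so the error is divided by [C + 1]. *)
  have C1 : 0 < C + 1 by rewrite ltr_wpDl.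
  have e1 : 0 < e / 2 / (C + 1) by rewrite !divr_gt0.
  have e2 : 0 < e / 2 by rewrite divr_gt0.
  near=> n.
  have h1 : n.+1%:R * (f t - f (t - n.+1%:R^-1)) <= - w t + e / 2.
    by near: n; apply: fwt.
  have : `|derive1 F t - n.+1%:R *: (F t - F (t - n.+1%:R^-1))| <= e / 2 / (C + 1).
    by near: n; apply: Fq.
  rewrite lee_fin /X => /(le_trans (ler_norm _)); rewrite ler_pdivlMr//.
  rewrite /GRing.scale/= => h2.
  have h3 : C * (derive1 F t - n.+1%:R * (F t - F (t - n.+1%:R^-1))) <= e / 2.
    set x := derive1 F t - _ in h2 *.
    have [x0|x0] := leP 0 x; last by rewrite (le_trans _ (ltW e2))// mulr_ge0_le0// ltW.
    by rewrite (le_trans _ h2)// [leRHS]mulrDr mulr1 [leRHS]addrC mulrC lerDr.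
  move: h1 h3; move: (n.+1%:R) (F (t - _)) (f (t - _)) (derive1 F t) => m p q r.
  by move=> h1 h3; nra.
under eq_integral do rewrite EFinD.
have mGT : measurable_fun setT G by move/integrableP : iG => [/measurable_EFinP].
rewrite ge0_integralD//; last 4 first.
- by move=> t _; rewrite lee_fin mulr_ge0.
- by apply/measurable_EFinP; apply: measurable_funTS; exact: measurable_funM.
- by move=> t _; rewrite lee_fin.
- by apply/measurable_EFinP; exact: measurable_funTS.
have iGab : mu.-integrable `[a, b]%classic (EFin \o G).
  by apply: integrableS iG => //; exact: measurable_itv.
have -> : (\int[mu]_(t in `[a, b]) (C * G t)%:E = (C * (F b - F a))%:E)%E.
  rewrite FB ?ltW// EFinM Rintegral_itv_obnd_cbnd; last first.
    by apply: integrableS iG => //; exact: measurable_itv.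
  rewrite /Rintegral fineK; last by apply: integrable_fin_num => //; exact: measurable_itv.
  exact: (integralZl _ iGab).
rewrite -leeBrDl// -EFinB; congr (_ <= _)%E; rewrite /X; congr (_%:E); ring.
Unshelve. all: by end_near. Qed.

End AbsolutelyContinuous.

(** * Descent along the trajectory *)

Section Descent.
Context {R : realType} {H : completeNormedModType R}.
Context (dot : {dot H for idfun}) (dot_norm : forall x : H, dot x x = `|x| ^+ 2).
Local Notation mu := (@lebesgue_measure R).

Lemma ae_neq (c : R) : {ae mu, forall t, t != c}.
Proof.
exists [set c]; split; [exact: measurable_set1|exact: lebesgue_measure_set1|].
by move=> t /=; case: eqP.
Qed.

Lemma continuous_of_modulus (V : normedModType R) (g : R -> V) (F : R -> R) :
  continuous F -> (forall s t, s <= t -> `|g t - g s| <= F t - F s) ->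
  continuous g.
Proof.
move=> cF gF x; apply/cvgrPdist_lt => e e0.
have /cvgrPdist_lt/(_ e e0) Fx := cF x.
apply: filterS Fx => y /= Fxy; have [xy|/ltW yx] := leP x y.
  by rewrite distrC (le_lt_trans (gF _ _ xy))// (le_lt_trans (ler_norm _))// distrC.
by rewrite (le_lt_trans (gF _ _ yx))// (le_lt_trans (ler_norm _)).
Qed.

(** The projection of the line onto [[0, T]]: composing with it extends a curve controlled on
    [[0, T]] to one controlled on all of [R]. *)
Definition clamp (T t : R) : R := Num.max 0 (Num.min t T).

Lemma clamp_id T t : 0 <= t -> t <= T -> clamp T t = t.
Proof. by move=> t0 tT; rewrite /clamp (min_idPl tT) (max_idPr t0). Qed.

Lemma clamp_ge0 T t : 0 <= clamp T t.
Proof. by rewrite /clamp le_max lexx. Qed.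

Lemma clamp_le T t : 0 <= T -> clamp T t <= T.
Proof. by move=> T0; rewrite /clamp ge_max T0/= ge_min lexx orbT. Qed.

Lemma absolutely_continuous_modulus (T : R) (u : R -> H) :
  0 < T -> absolutely_continuous_on T u ->
  exists G F : R -> R, [/\ forall t, 0 <= G t,
    mu.-integrable setT (EFin \o G),
    [/\ continuous F, {homo F : x y / x <= y} &
      forall s t, s <= t -> F t - F s = \int[mu]_(x in `]s, t]) G x],
    {ae mu, forall t, derivable F t 1 /\ derive1 F t = G t} &
    forall s t, s <= t ->
      `|u (clamp T t) - u (clamp T s)| <= F t - F s].
Proof.
move=> T0 uac.
have [G [G0 iG uG]] := absolutely_continuous_majorant dot_norm T0 uac.
have [F [cF Fnd FB dF]] := cumulative_function G0 iG.
exists G, F; split => // s t st.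
have kT x : clamp T x <= T by apply: clamp_le; exact: ltW.
have kst : clamp T s <= clamp T t.
  by rewrite /clamp ge_max le_max lexx/= le_max le_min !ge_min st lexx !orbT.
have [->|kn] := eqVneq (clamp T s) (clamp T t).
  by rewrite subrr normr0 subr_ge0 Fnd.
have klt : clamp T s < clamp T t by rewrite lt_neqAle kn.
(* Distinct clamped times force [0 < t] and [s < T], so [clamp T t <= t] and [s <= clamp T s];
   monotonicity of [F] concludes. *)
rewrite (le_trans (uG _ _ (clamp_ge0 T s) kst (kT t)))// -FB// lerB// Fnd//.
  have := le_lt_trans (clamp_ge0 T s) klt.
  rewrite /clamp lt_max ltxx/= => kt0.
  by rewrite ge_max ge_min lexx andbT (le_trans (ltW kt0))// ge_min lexx.
have := lt_le_trans klt (kT t).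
rewrite /clamp gt_max T0/= gt_min ltxx orbF => sT.
by rewrite (min_idPl (ltW sT)) le_max lexx orbT.
Qed.

Lemma absolutely_continuous_continuous (u : R -> H) (t : R) :
  (forall T : R, 0 < T -> absolutely_continuous_on T u) ->
  0 < t -> {for t, continuous u}.
Proof.
move=> uac t0; have T0 : 0 < t + 1 by rewrite addr_gt0.
have [G [F [_ _ [cF _ _] _ uF]]] := absolutely_continuous_modulus T0 (uac _ T0).
have := continuous_of_modulus cF uF.
move=> /(_ t); rewrite /continuous_at clamp_id ?ltW// ?ltrDl//.
apply: cvg_trans; apply: near_eq_cvg; near=> s.
rewrite clamp_id//; near: s.
  by apply: (cvgr_ge t cvg_id).
by apply: (cvgr_le t cvg_id); rewrite ltrDl.
Unshelve. all: by end_near. Qed.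

(* No differentiability of [f \o u] is needed: the subgradient inequality
   bounds its backward difference quotients. *)
Lemma descent (u : R -> H) (f : H -> R) (w : R -> R) (a b : R) :
  (forall T : R, 0 < T -> absolutely_continuous_on T u) ->
  (forall B : set H, bounded_set B -> [lipschitz f x | x in B]) ->
  measurable_fun setT w -> (forall t, 0 <= w t) -> 0 <= a -> a < b ->
  {ae mu, forall t, 0 < t -> derivable u t 1 /\
    exists2 p, subdifferential dot f (u t) p & dot p (derive1 u t) <= - w t} ->
  (\int[mu]_(t in `[a, b]) (w t)%:E <= (f (u a) - f (u b))%:E)%E.
Proof.
move=> uac flip mw w0 a0 ab ae_u.
pose T := b + 1; have bT : b < T by rewrite ltrDl.
have T0 : 0 < T by rewrite (le_lt_trans a0)// (lt_trans ab).
have [G [F [G0 iG [cF Fnd FB] dF UF]]] := absolutely_continuous_modulus T0 (uac _ T0).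
pose k := clamp T.
have kE t : 0 <= t -> t <= T -> k t = t by exact: clamp_id.
have k0 t : 0 <= k t by exact: clamp_ge0.
have kT t : k t <= T by apply: clamp_le; exact: ltW.
(* The trajectory up to time [T], bounded through the modulus [F], is the bounded set on which the
   Lipschitz constant of [f] is taken. *)
pose B := [set u (k t) | t in setT].
have Bb : bounded_set B.
  have [y ub] : exists y, forall t, `|u (k t)| <= y.
    exists (`|u (k 0)| + (F T - F 0)) => t.
    rewrite -[X in `|X| <= _](subrK (u (k 0))) addrC (le_trans (ler_normD _ _))//.
    rewrite lerD2l.
    have -> : u (k t) = u (k (k t)) by rewrite [k (k t)]kE.
    by rewrite (le_trans (UF 0 (k t) (k0 t)))// lerB// Fnd.
  exists y; split; first exact: num_real.
  by move=> M yM x [t _ <-] /=; exact: le_trans (ub t) (ltW yM).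
have [L [L0 fL]] : exists L : R, 0 <= L /\
    forall s t, `|f (u (k t)) - f (u (k s))| <= L * `|u (k t) - u (k s)|.
  (* The Lipschitz property holds for every constant beyond [M], which may be negative; [|M| + 1] is
     admissible and nonnegative. *)
  have [M [_ hM]] := flip B Bb.
  exists (`|M| + 1); split; first by rewrite addr_ge0.
  move=> s t; have := hM (`|M| + 1).
  rewrite (le_lt_trans (ler_norm _)) ?ltrDl// => /(_ isT (u (k t), u (k s))).
  by apply; split; [exists t|exists s].
have fF s t : s <= t -> `|f (u (k t)) - f (u (k s))| <= L * (F t - F s).
  by move=> st; rewrite (le_trans (fL _ _))// ler_wpM2l// UF.
have cf : continuous (fun t => f (u (k t))).
  apply: (@continuous_of_modulus R^o _ (fun t => L * F t)) => [t|s t st].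
    by apply: cvgMr; exact: cF.
  by rewrite -mulrBr fF.
have -> : f (u a) = f (u (k a)) by rewrite kE// ltW// (lt_trans ab).
have -> : f (u b) = f (u (k b)) by rewrite kE// ltW// (le_lt_trans a0).
apply: (@integral_le_of_quotient _ G F (fun t => f (u (k t))) w L) => //.
(* Time 0 is discarded: [a] may be 0, while the hypothesis on [u] concerns positive times. *)
apply: (@filterS2 _ _ (ae_filter_ringOfSetsType mu) _ _ _ _ (ae_neq 0) ae_u).
move=> t t0 + tab e e0.
move: tab; rewrite in_itv/= => /andP[at_ tb].
have {}t0 : 0 < t by rewrite lt_neqAle eq_sym t0 (le_trans a0).
move=> /(_ t0) [du [p pf pw]].
have qc : dot p (n.+1%:R *: (u t - u (t - n.+1%:R^-1))) @[n --> \oo] -->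
    dot p (derive1 u t).
  by apply: (cvg_dot dot_norm (cvg_cst _)); exact: cvg_left_quotient.
near=> n.
have nt : (n.+1%:R^-1 : R) < t by near: n; exact: (near_infty_natSinv_lt (PosNum t0)).
have n0 : 0 < (n.+1%:R^-1 : R) by rewrite invr_gt0.
have tT : t <= T by rewrite (le_trans tb)// ltW.
have -> : k t = t by rewrite kE// ltW.
have -> : k (t - n.+1%:R^-1) = t - n.+1%:R^-1.
  by rewrite kE ?subr_ge0 ?ltW// (lt_le_trans _ tT)// gtrBl.
apply: (@le_trans _ _ (dot p (n.+1%:R *: (u t - u (t - n.+1%:R^-1))))).
  rewrite dotZr ler_wpM2l//.
  have := pf (u (t - n.+1%:R^-1)).
  by rewrite -[u (t - _) - u t]opprB dotNr; lra.
near: n; apply: (cvgr_le _ qc).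
by rewrite (le_lt_trans pw)// ltrDl.
Unshelve. all: by end_near. Qed.

End Descent.

(** * Feasibility of the trajectory and consequences of the minimal norm *)

Section Trajectory.
Context {R : realType} {H : completeNormedModType R}.
Context (dot : {dot H for idfun}) (dot_norm : forall x : H, dot x x = `|x| ^+ 2).
Context (K : set H) (K_closed : closed K) (q : nat) (f : 'I_q -> H -> R).
Context (u : R -> H).
Context (u_ac : forall T : R, 0 < T -> absolutely_continuous_on T u).
Local Notation mu := (@lebesgue_measure R).

(** A ball has positive measure, so it cannot be contained in a null set. *)
Lemma ae_dense (P : R -> Prop) (t : R) (V : set R) :
  {ae mu, forall s, P s} -> nbhs t V -> exists2 s, V s & P s.
Proof.
move=> [N [mN muN PN]] /nbhs_ballP[e /= e0 eV]; apply: contrapT => nP.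
have BN : ball t e `<=` N.
  by move=> s ts; apply: PN => Ps; apply: nP; exists s => //; exact: eV.
have : (mu (ball t e) <= mu N)%E.
  by apply: le_measure => //; apply: mem_set => //; exact: measurable_ball.
by rewrite muN (lebesgue_measure_ball _ (ltW e0)) lee_fin leNgt mulrn_wgt0.
Qed.

(** If [u t] were outside the closed set [K], continuity would keep [u] outside on a whole
    neighbourhood, which contains a time where membership holds. *)
Lemma trajectory_in : {ae mu, forall t, 0 < t -> K (u t)} ->
  forall t, 0 < t -> K (u t).
Proof.
move=> aeK t t0; apply: contrapT => nK.
have : nbhs t (u @^-1` (~` K) `&` [set s | 0 < s]).
  apply: filterI; last exact: (cvgr_gt t cvg_id).
  apply: (absolutely_continuous_continuous dot_norm u_ac t0).
  by apply: open_nbhs_nbhs; split => //; exact: closed_openC.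
by move=> /(ae_dense aeK)[s [nKs s0] Ks]; exact/nKs/Ks.
Qed.

Lemma dot_ge0_of_min_norm (z d : H) :
  (forall l : R, 0 < l < 1 -> `|z| <= `|z + l *: d|) -> 0 <= dot z d.
Proof.
move=> zd; rewrite leNgt; apply/negP => zd0.
(* If [dot z d] is negative, this [l] makes [2 * dot z d + l * |d|^2] negative, so a step [l] along
   [d] shortens [z]; the bound [2^-1] keeps [l] below 1. *)
pose l : R := Num.min 2^-1 (- dot z d / (`|d| ^+ 2 + 1)).
have d1 : 0 < `|d| ^+ 2 + 1 by rewrite ltr_wpDl ?sqr_ge0.
have l0 : 0 < l by rewrite lt_min invr_gt0 ltr0n divr_gt0// oppr_gt0.
have l1 : l < 1 by rewrite gt_min invf_lt1 ?ltr1n.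
have ld : l * (`|d| ^+ 2 + 1) <= - dot z d by rewrite -ler_pdivlMr// ge_min lexx orbT.
have := zd l; rewrite l0 l1 => /(_ isT).
rewrite -(@ler_pXn2r _ 2)// ?nnegrE// (normD_sqr dot_norm) dotZr normrZ exprMn.
rewrite (gtr0_norm l0); clearbody l.
move: zd0 d1 l0 ld; move: (dot z d) (`|d| ^+ 2) (`|z| ^+ 2) => c n m zd0 d1 l0 ld h.
have : 0 <= l * (2 * c + l * n) by lra.
by rewrite pmulr_rge0// => ?; lra.
Qed.

(** The second property expands [dot z (v - u t)]: the normal cone part is nonpositive and each
    subgradient part is bounded by the subgradient inequality. It later yields both the decrease of
    distances and a lower bound on the speed. *)
Lemma mog_min_norm t (z : H) : (forall s, 0 < s -> K (u s)) -> 0 < t ->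
  derivable u t 1 -> is_min_norm (mog_set dot K f (u t)) z ->
  derive1 u t + z = 0 ->
  (forall i, exists2 p, subdifferential dot (f i) (u t) p &
     dot p (derive1 u t) <= - `|derive1 u t| ^+ 2) /\
  (forall v, K v -> exists2 theta : 'I_q -> R, simplex theta &
     dot (derive1 u t) (u t - v) <= \sum_i theta i * (f i v - f i (u t))).
Proof.
move=> uK t0 du [[x [Kt Nx] [_ [theta [p [[th0 th1] pf ->]]] zE]] zmin] /eqP.
rewrite addr_eq0 => /eqP uz.
split=> [i|v Kv].
  exists (p i) => //.
  (* The earlier points of the trajectory lie in [K], so normality of [x] gives a sign to the
     backward quotients, hence to their limit. *)
  have xu : 0 <= dot x (derive1 u t).
    have qc : dot x (n.+1%:R *: (u t - u (t - n.+1%:R^-1))) @[n --> \oo] -->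
        dot x (derive1 u t).
      by apply: (cvg_dot dot_norm (cvg_cst _)); exact: cvg_left_quotient.
    apply: (cvgr_to_ge qc); near=> n.
    have nt : (n.+1%:R^-1 : R) < t.
      by near: n; exact: (near_infty_natSinv_lt (PosNum t0)).
    rewrite dotZr mulr_ge0// -opprB dotNr oppr_ge0; apply: Nx.
    by apply: uK; rewrite subr_gt0.
  pose y := x + p i.
  have zy l : 0 < l < 1 -> `|z| <= `|z + l *: (y - z)|.
    move=> /andP[l0 l1]; apply: zmin.
    exists x; first by split.
    (* On the segment from [z] to [x + p i] the normal vector [x] stays fixed, while the weights
       move from [theta] to the [i]-th vertex of the simplex. *)
    exists (\sum_j ((1 - l) * theta j + l * (j == i)%:R) *: p j).
      exists (fun j => (1 - l) * theta j + l * (j == i)%:R), p; split => //.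
      split=> [j|].
        have /andP[tj0 tj1] := th0 j.
        by case: (j == i); rewrite /= ?mulr1 ?mulr0 ?addr0; apply/andP; split; nra.
      rewrite big_split/= -!mulr_sumr th1 (bigD1 i)//= ?eqxx big1 ?addr0.
        by rewrite !mulr1 subrK.
      by move=> j /negbTE ->.
    rewrite (eq_bigr (fun j => (1 - l) *: (theta j *: p j) + l *: ((j == i)%:R *: p j))).
      have Spi : \sum_j ((j == i)%:R *: p j) = p i.
        rewrite (bigD1 i)//= eqxx scale1r big1 ?addr0// => j /negbTE ->.
        by rewrite scale0r.
      rewrite big_split/= -!scaler_sumr Spi /y -zE; set S := \sum_j _.
      rewrite opprD addrACA subrr add0r scalerBr scalerBl scale1r.
      by rewrite -!addrA [- _ + _]addrC.
    by move=> j _; rewrite scalerDl !scalerA.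
  have zyz : 0 <= dot z (y - z) by exact: dot_ge0_of_min_norm.
  move: zyz; rewrite dotBr dot_norm /y dotDr uz dotNr normrN.
  move: xu; rewrite uz dotNr (dotC dot x) (dotC dot (p i)).
  by move=> *; lra.
exists theta => //.
rewrite uz -[in leLHS]zE dotNl -dotNr opprB dotDl.
have h1 := Nx v Kv.
rewrite -[leRHS]add0r lerD//.
rewrite -applyrE raddf_sum/=; apply: ler_sum => i _.
have /andP[ti0 _] := th0 i.
by rewrite dotZl ler_wpM2l// lerBrDl; apply: pf.
Unshelve. all: by end_near. Qed.

End Trajectory.

(** * Measurability of the speed, and the squared distance as a function to which descent applies *)

Section Speed.
Context {R : realType} {H : completeNormedModType R}.
Context (dot : {dot H for idfun}) (dot_norm : forall x : H, dot x x = `|x| ^+ 2).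
Local Notation mu := (@lebesgue_measure R).

(* [derive1 u] is arbitrary where [u] is not derivable, hence possibly not
   Borel: its squared norm is replaced by an almost everywhere equal function. *)
Lemma speed_sqr_measurable (u : R -> H) :
  (forall T : R, 0 < T -> absolutely_continuous_on T u) ->
  {ae mu, forall t, 0 < t -> derivable u t 1} ->
  exists w : R -> R, [/\ measurable_fun setT w, forall t, 0 <= w t &
    {ae mu, forall t, 0 < t -> w t = `|derive1 u t| ^+ 2}].
Proof.
move=> uac [N [mN muN dN]].
pose A := `]0, +oo[%classic `\` N.
have mA : measurable A by apply: measurableD => //; exact: measurable_itv.
have dA t : A t -> 0 < t /\ derivable u t 1.
  move=> [/=]; rewrite in_itv/= andbT => t0 nN; split => //.
  by apply: contrapT => nd; apply: nN; apply: dN => /= /(_ t0).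
pose sp : R -> R := fun t => `|derive1 u t| ^+ 2.
have mwA : measurable_fun A sp.
  (* Forward quotients evaluate [u] only at positive times, where its continuity is available. *)
  pose sq n : R -> R := fun t => `|n.+1%:R *: (u (n.+1%:R^-1 + t) - u t)| ^+ 2.
  apply: (@measurable_fun_cvg _ _ _ _ sq); last first.
    move=> t /dA[_ dt]; rewrite /sq /sp.
    have h := cvg_norm (cvg_right_quotient dt).
    exact: (cvgM (h _) (h _)).
  move=> n; suff mI : measurable_fun (`]0, +oo[ : set R) (sq n).
    by apply: measurable_funS mI; [exact: measurable_itv|move=> t []].
  apply: open_continuous_measurable_fun; first exact: interval_open.
  move=> t /set_mem/=; rewrite in_itv/= andbT => t0.
  have h : (fun s => `|n.+1%:R *: (u (n.+1%:R^-1 + s) - u s)|) @ t -->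
      `|n.+1%:R *: (u (n.+1%:R^-1 + t) - u t)|.
    apply: cvg_norm; apply: cvgZr; apply: cvgB; last first.
      exact: (absolutely_continuous_continuous dot_norm uac t0).
    apply: (@continuous_comp _ _ _ (fun s : R => n.+1%:R^-1 + s) u).
      by apply: cvgD; [exact: cvg_cst|exact: cvg_id].
    by apply: (absolutely_continuous_continuous dot_norm uac); rewrite addr_gt0.
  exact: (cvgM h h).
exists (sp \_ A); split.
- exact/(measurable_restrictT _ _).1.
- by move=> t; rewrite patchE; case: ifP => // _; exact: sqr_ge0.
- exists N; split => // t /=; apply: contra_notP => nNt t0.
  rewrite patchE mem_set//; split => //=.
  by rewrite in_itv/= andbT.
Qed.

(** With the subgradient computed in [subdifferential_dist_sqr], this lets [descent] be applied to
    the squared distance to [z]. *)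
Lemma lipschitz_dist_sqr (z : H) (B : set H) : bounded_set B ->
  [lipschitz (`|x - z| ^+ 2) | x in B].
Proof.
move=> [M [_ BM]]; pose b := `|M| + 1.
have Bb x : B x -> `|x| <= b.
  by apply: BM; rewrite (le_lt_trans (ler_norm _))// ltrDl.
exists (2 * (b + `|z|)); split; first exact: num_real.
move=> k kb [x y] [/= Bx By].
rewrite subr_sqr normrM mulrC (le_trans _ (ler_wpM2r _ (ltW kb)))//.
apply: ler_pM => //; last first.
  by rewrite (le_trans (ler_dist_dist _ _))// opprB addrA subrK.
rewrite ger0_norm ?addr_ge0// mulrDr !mulr2n !mulrDl !mul1r addrACA.
by apply: lerD; rewrite (le_trans (ler_normB _ _))// lerD2r Bb.
Qed.

Lemma subdifferential_dist_sqr (z x : H) :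
  subdifferential dot (fun y : H => `|y - z| ^+ 2) x (2 *: (x - z)).
Proof.
move=> y; have -> : y - z = (y - x) + (x - z) by rewrite addrA subrK.
rewrite (normD_sqr dot_norm (y - x)) dotZl (dotC dot (y - x)) addrC.
by rewrite lerD2r lerDr sqr_ge0.
Qed.

End Speed.

Theorem theorem2p2 (R : realType) (H : completeNormedModType R)
    (dot : {dot H for idfun}) (dot_norm : forall x : H, dot x x = `|x| ^+ 2)
    (K : set H) (K_neq0 : K !=set0) (K_closed : closed K)
    (K_convex : convex_set K)
    (q : nat) (q_ge1 : (1 <= q)%N) (f : 'I_q -> H -> R)
    (f_convex : forall i, convex_function setT (f i))
    (f_continuous : forall i, continuous (f i))
    (f_lipschitz : forall i (B : set H), bounded_set B ->
      [lipschitz f i x | x in B])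
    (f_bounded_below : forall i, has_lbound (range (f i)))
    (u : R -> H) (u_solution : strong_global_solution dot K f u) :
  (\int[@lebesgue_measure R]_(t in `]0%R, +oo[) (`|derive1 u t| ^+ 2)%:E < +oo)%E /\
  (bounded_set (u @` `[0, +oo[) ->
    exists2 uinf : H, weak_pareto K f uinf & weakly_cvg_pinfty dot u uinf).
Proof.
have [u_ac [eta [v [th [_ _ _ _ ae_sol]]]]] := u_solution.
pose mu := @lebesgue_measure R.
have aeF := ae_filter_ringOfSetsType mu.
have uK : forall t, 0 < t -> K (u t).
  apply: (trajectory_in dot_norm K_closed u_ac).
  by apply: (@filterS _ _ aeF _ _ _ ae_sol) => t ut t0; have [[]] := ut t0.
have ae_u : {ae mu, forall t, 0 < t -> [/\ derivable u t 1,
    forall i, exists2 p, subdifferential dot (f i) (u t) p &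
      dot p (derive1 u t) <= - `|derive1 u t| ^+ 2 &
    forall z, K z -> exists2 theta : 'I_q -> R, simplex theta &
      dot (derive1 u t) (u t - z) <= \sum_i theta i * (f i z - f i (u t))]}.
  apply: (@filterS _ _ aeF _ _ _ ae_sol) => t ut t0.
  have [_ _ du _ [z zmin uz]] := ut t0.
  by have [] := mog_min_norm dot_norm uK t0 du zmin uz.
have [|w [mw w0 wE]] := speed_sqr_measurable dot_norm u_ac.
  by apply: (@filterS _ _ aeF _ _ _ ae_u) => t ut t0; have [] := ut t0.
have energy i a b : 0 <= a -> a < b ->
    (\int[mu]_(t in `[a, b]) (w t)%:E <= (f i (u a) - f i (u b))%:E)%E.
  move=> a0 ab; apply: (descent dot_norm u_ac (@f_lipschitz i)) => //.
  apply: (@filterS2 _ _ aeF _ _ _ _ ae_u wE) => t ut wt t0.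
  by have [du dp _] := ut t0; split=> //; rewrite wt.
have f_decr i s t : 0 <= s -> s <= t -> f i (u t) <= f i (u s).
  move=> s0; rewrite le_eqVlt => /predU1P[->//|st].
  rewrite -subr_ge0 -lee_fin; apply: le_trans (energy i _ _ s0 st).
  by apply: integral_ge0 => x _; rewrite lee_fin.
pose i0 : 'I_q := Ordinal q_ge1.
have [m fm] := f_bounded_below i0.
pose E := f i0 (u 0) - m.
have wbound b : 0 < b -> (\int[mu]_(t in `[0%R, b]) (w t)%:E <= E%:E)%E.
  move=> b0; apply: le_trans (energy i0 _ _ (lexx 0) b0) _.
  by rewrite lee_fin lerB// fm//; exists (u b).
split.
  apply: (@le_lt_trans _ _ E%:E); last exact: ltry.
  (* The squared speed is replaced by its measurable version [w], whose integral over the half-line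
     is the limit of those over [[0, n]], all at most [E]. *)
  apply: (@le_trans _ _ (\int[mu]_(t in `[0%R, +oo[) (w t)%:E)%E).
    rewrite -integral_itv_obnd_cbnd; last first.
      by apply/measurable_EFinP; exact: measurable_funTS.
    apply: le_integral_ae => [t _|t _|]; rewrite ?lee_fin ?sqr_ge0//.
    apply: (@filterS _ _ aeF _ _ _ wE) => t wt.
    by rewrite /= in_itv/= andbT => /wt ->.
  apply: (cvge_to_le (ge0_cvgn_integral (mu := mu) w0 mw)).
  by near=> n; apply: wbound; rewrite ltr0n; near: n; exists 1%N.
move=> [B [_ uB]].
have ub t : 0 <= t -> `|u t| <= `|B| + 1.
  move=> t0; apply: (uB (`|B| + 1)).
    by rewrite (le_lt_trans (ler_norm _))// ltrDl.
  by exists t => //=; rewrite in_itv/= andbT.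
(* Since each [f i (u t)] is nonincreasing in [t], bounding [f i z] by all its values amounts to
   bounding it by the limit. *)
pose S := [set z | K z /\ forall i t, 0 <= t -> f i z <= f i (u t)].
have [z Sz|s x sy xc|l [Kl fl] ul] := @opial _ _ _ dot_norm u S _ ub.
- have [Kz fz] := Sz.
  have decr s t : 0 <= s -> s <= t -> `|u t - z| <= `|u s - z|.
    move=> s0; rewrite le_eqVlt => /predU1P[->//|st].
    rewrite -(@ler_pXn2r _ 2)// ?nnegrE// -subr_ge0 -lee_fin.
    (* Descent at rate zero: half the derivative of the squared distance is at most a convex
       combination of the [f i z - f i (u x)], all nonpositive as [z] is in [S]. *)
    have : (\int[mu]_(t in `[s, t]) (0%R : R)%:E <=
        (`|u s - z| ^+ 2 - `|u t - z| ^+ 2)%:E)%E.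
      apply: (descent dot_norm u_ac (f := fun x => `|x - z| ^+ 2)
        (@lipschitz_dist_sqr _ _ z)) => //.
      apply: (@filterS _ _ aeF _ _ _ ae_u) => x ux x0.
      have [du _ uz] := ux x0; split=> //.
      exists (2 *: (u x - z)); first exact: subdifferential_dist_sqr.
      rewrite oppr0 dotZl (dotC dot) mulr_ge0_le0//.
      have [theta [th0 _] thz] := uz z Kz; apply: le_trans thz _.
      apply: sumr_le0 => i _; have /andP[t0 _] := th0 i.
      by rewrite mulr_ge0_le0// subr_le0 fz// ltW.
    by rewrite integral0.
  (* The sign and the truncation at 0 make the distance a nondecreasing function on all of [R], so
     that monotone convergence applies. *)
  pose g t : R := - `|u (Num.max t 0) - z|.
  have gnd : {homo g : s t / s <= t}.
    move=> s t st; rewrite lerN2; apply: decr; first by rewrite le_max lexx orbT.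
    by rewrite ge_max !le_max st lexx !orbT.
  have gub : has_ubound (range g) by exists 0 => _ [t _ <-]; rewrite oppr_le0.
  exists (- sup (range g)); apply: cvg_trans (cvgN (nondecreasing_cvgr gnd gub)).
  apply: near_eq_cvg; near=> t.
  by rewrite /= /g opprK (max_idPl _)//; near: t; exact: nbhs_pinfty_ge.
(* [K] and the sublevel sets at [f i (u t)] are closed convex and contain the tails of [u (s n)]. *)
- split.
    apply: xc; first exact: closed_convex_set.
    have [N _ sN] : \forall n \near \oo, 0 < s n by exact: (cvgry_gt sy 0).
    by exists N => n Nn; apply: uK; exact: sN.
  move=> i t t0; apply: (xc [set y | f i y <= f i (u t)]).
    exact: closed_convex_sublevel.
  have [N _ sN] : \forall n \near \oo, t <= s n by exact: (cvgry_ge sy t).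
  by exists N => n Nn; apply: f_decr => //; exact: sN.
exists l => //; split => // -[z Kz fz].
(* The smallest gain of [z] over [l]; the default 1 is positive and can only lower [d], so both
   [0 < d] and the bounds [dle] survive. *)
pose d : R := \big[Num.min/1]_i (f i l - f i z).
have d0 : 0 < d by apply: lt_bigmin => // i _; rewrite subr_gt0.
have dle i : d <= f i l - f i z by exact: bigmin_le_cond.
pose D := `|B| + 1 + `|z|.
have D0 : 0 < D by rewrite /D ltr_wpDr// ltr_wpDl.
have wge : {ae mu, forall t, 0 < t -> (d / D) ^+ 2 <= w t}.
  apply: (@filterS2 _ _ aeF _ _ _ _ ae_u wE) => t ut wt t0.
  have [_ _ uz] := ut t0; rewrite wt//.
  have [theta [th0 th1] thz] := uz z Kz.
  (* As [f i l <= f i (u t)], every term [f i z - f i (u t)] is at most [- d], and so is their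
     convex combination; Cauchy-Schwarz and the bound [D] on the distance to [z] give the speed. *)
  have {}thz : d <= `|derive1 u t| * D.
    have : d <= - dot (derive1 u t) (u t - z).
      rewrite lerNr (le_trans thz)// -[leRHS]mul1r -th1 mulr_suml.
      apply: ler_sum => i _; have /andP[ti0 _] := th0 i.
      rewrite ler_wpM2l// lerNr opprB (le_trans (dle i))// lerD2r.
      by apply: fl; exact: ltW.
    move=> /le_trans; apply; rewrite -dotNl (le_trans (ler_norm _))//.
    rewrite (le_trans (cauchy_schwarz dot_norm _ _))// normrN ler_wpM2l//.
    by rewrite (le_trans (ler_normB _ _))// lerD2r ub// ltW.
  by rewrite lerXn2r ?nnegrE ?divr_ge0 ?(ltW d0) ?(ltW D0)// ler_pdivrMr.
pose c := (d / D) ^+ 2; have c0 : 0 < c by rewrite exprn_gt0// divr_gt0.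
have E0 : 0 <= E by rewrite subr_ge0; apply: fm; exists (u 0).
(* Chosen so that [c * b = E + c] exceeds the energy bound [E]. *)
pose b := E / c + 1; have b0 : 0 < b by rewrite ltr_wpDl// divr_ge0// ltW.
have : (\int[mu]_(t in `[0%R, b]) c%:E <= E%:E)%E.
  apply: le_trans (wbound b b0); apply: le_integral_ae => [t _|t _|].
  - by rewrite lee_fin ltW.
  - by rewrite lee_fin.
  apply: (@filterS2 _ _ aeF _ _ _ _ wge (ae_neq 0)) => t ct tn0.
  rewrite /= in_itv/= => /andP[t0 _]; rewrite lee_fin ct//.
  by rewrite lt_neqAle eq_sym tn0.
rewrite integral_cst//= lebesgue_measure_itv/= lte_fin b0 -EFinB subr0 -EFinM.
rewrite lee_fin leNgt => /negP; apply.
by rewrite /b mulrDr mulr1 mulrCA divff ?mulr1 ?ltrDl// gt_eqF.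
Unshelve. all: by end_near. Qed.
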